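(* For all integers $\ell\geq 0$ and $n\geq 1$, $$Av_n(1-_\ell 3-_\ell 2)\leq Av_n(1-_\ell 2-_\ell 3),$$ with strict inequality if and only if $\ell\geq 1$ and $n\geq 2\ell+4$.
   Context: $S_n$ is the set of permutations of $\{1,\ldots,n\}$, and $\sigma_i=\sigma(i)$ for $\sigma\in S_n$. For an integer $\ell\geq 0$, a permutation $\sigma\in S_n$ contains the gap pattern $1-_\ell 2-_\ell 3$ (respectively, $1-_\ell 3-_\ell 2$) if there exist indices $1\leq i\leq j\leq k\leq n$ with $i+\ell<j$ and $j+\ell<k$ such that $\sigma_i<\sigma_j<\sigma_k$ (respectively, $\sigma_i<\sigma_k<\sigma_j$). Otherwise $\sigma$ avoids the gap pattern. $Av_n(1-_\ell 2-_\ell 3)$ (respectively, $Av_n(1-_\ell 3-_\ell 2)$) denotes the number of permutations in $S_n$ that avoid the gap pattern $1-_\ell 2-_\ell 3$ (respectively, $1-_\ell 3-_\ell 2$). *)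

(* Defs.v *)
From mathcomp Require Import all_boot all_fingroup.

Set Implicit Arguments.
Unset Strict Implicit.
Unset Printing Implicit Defensive.

(* Permutations of {1, ..., n} are represented by 'S_n, the permutations of
   {0, ..., n-1}; positions and values are both shifted by one, which affects
   none of the comparisons below. *)

Definition contains_gap_123 (l n : nat) (s : 'S_n) : bool :=
  [exists i : 'I_n, exists j : 'I_n, exists k : 'I_n,
    [&& i <= j <= k, i + l < j, j + l < k & s i < s j < s k]].

Definition contains_gap_132 (l n : nat) (s : 'S_n) : bool :=
  [exists i : 'I_n, exists j : 'I_n, exists k : 'I_n,
    [&& i <= j <= k, i + l < j, j + l < k & s i < s k < s j]].

Definition Av_123 (l n : nat) : nat :=
  #|[set s : 'S_n | ~~ contains_gap_123 l s]|.

Definition Av_132 (l n : nat) : nat :=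
  #|[set s : 'S_n | ~~ contains_gap_132 l s]|.

(* Main.v *)
Require Import Defs.
From mathcomp Require Import all_boot all_fingroup zify.

Set Implicit Arguments.
Unset Strict Implicit.
Unset Printing Implicit Defensive.

(** A permutation is built by giving positions to the values in increasing
    order. Let U be the set of positions already used, so U holds the smaller
    values. The next value may always go to an unused position that is free, one
    with no used position more than l to its left, since it cannot then be the
    2 or the 3 of an occurrence. Call the other unused positions released, and
    let the next value go to a released position k. It plays the 2 of an
    occurrence of 1-2-3 exactly when some unused position lies more than l to the
    right of k; it plays the 2 of an occurrence of 1-3-2 exactly when some
    released position lies more than l to the left of k. Hence avoiders of 1-2-3
    are the ways to fill the board when released positions are taken from the
    right window (those within l of the greatest released position), and
    avoiders of 1-3-2 the ways to do so from the left window (within l of the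
    least). This is card_moves, Av_132_completions and Av_123_completions.

    It remains to compare these two games; FL U and FR U count their
    completions from U. By induction it is enough to compare one left move and
    one right move, both followed by the right-window game. This is done for any
    upper part T of the unused positions that is already released: sumL U T and
    sumR U T count continuations after a first move in the left, respectively
    right, window of T. If T has diameter at most l, both windows are T. If
    not, a left move and a right move commute, so expanding the second move
    writes sumL U T as a sum of sumL's with one more position used, and sumR U T
    as the same sum of sumR's plus a nonnegative excess, coming from second moves
    that the first right move makes possible below T. Induction gives sumL U T <= sumR U T.

    A positive excess needs released positions d < a and b in the right window,
    with a + l < b and all of T but b within l of d. When l = 0, or when
    n <= 2 l + 3, there is no room for such a configuration, all excesses vanish
    and the two counts agree. Otherwise a state with positive excess can be
    reached by explicit moves (FL_lt_FR0), which gives strictness. *)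

Lemma ltn_sum_at (I : finType) (A : {pred I}) (f g : I -> nat) (k : I) :
  k \in A -> (forall i, i \in A -> f i <= g i) -> f k < g k ->
  \sum_(i in A) f i < \sum_(i in A) g i.
Proof.
move=> kA le lt; rewrite !(bigD1 k kA) /= -addSn leq_add //.
by apply: leq_sum => i /andP[iA _]; apply: le.
Qed.

(** * The placement game *)

Section Game.
Variables l n : nat.
Implicit Types (U T : {set 'I_n}) (i j k x y : 'I_n).
Implicit Type win : {set 'I_n} -> {set 'I_n}.

Definition early U k := [forall i in U, k <= i + l].
Definition free U := [set k | (k \notin U) && early U k].
Definition released U := [set k | (k \notin U) && ~~ early U k].

(** The windows avoid any mention of the least and the greatest element, so that
    the empty set needs no convention. *)
Definition lwin T := [set x in T | [forall y in T, x <= y + l]].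
Definition rwin T := [set x in T | [forall y in T, y <= x + l]].
Definition moves win U := free U :|: win (released U).

Fixpoint count_rec win m U :=
  if m is m'.+1 then \sum_(k in moves win U) count_rec win m' (k |: U) else 1.
Definition completions win U := count_rec win #|~: U| U.

Lemma lwinP T x :
  reflect (x \in T /\ forall y, y \in T -> x <= y + l) (x \in lwin T).
Proof.
rewrite inE; apply: (iffP andP) => -[xT h]; split=> //.
  by move=> y yT; apply: (implyP (forallP h y)).
by apply/forallP=> y; apply/implyP; apply: h.
Qed.

Lemma rwinP T x :
  reflect (x \in T /\ forall y, y \in T -> y <= x + l) (x \in rwin T).
Proof.
rewrite inE; apply: (iffP andP) => -[xT h]; split=> //.
  by move=> y yT; apply: (implyP (forallP h y)).
by apply/forallP=> y; apply/implyP; apply: h.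
Qed.

Lemma freeP U k :
  reflect (k \notin U /\ forall i, i \in U -> k <= i + l) (k \in free U).
Proof.
rewrite inE; apply: (iffP andP) => -[kU h]; split=> //.
  by move=> y yT; apply: (implyP (forallP h y)).
by apply/forallP=> y; apply/implyP; apply: h.
Qed.

Lemma releasedP U k :
  reflect (k \notin U /\ exists2 i, i \in U & i + l < k) (k \in released U).
Proof.
rewrite inE; apply: (iffP andP) => -[kU h]; split=> //.
  move: h; rewrite negb_forall => /existsP[i]; rewrite negb_imply -ltnNge.
  by move=> /andP[]; exists i.
case: h => i iU ik; rewrite negb_forall; apply/existsP; exists i.
by rewrite negb_imply iU -ltnNge.
Qed.

Lemma free_or_released U k : k \notin U -> (k \in free U) || (k \in released U).
Proof. by rewrite !inE => ->; rewrite orbN. Qed.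

Lemma free_released U k : k \in free U -> k \in released U -> False.
Proof. by rewrite !inE => /andP[-> ->]. Qed.

Lemma lwin_sub T : lwin T \subset T.
Proof. by apply/subsetP=> x /lwinP[]. Qed.

Lemma rwin_sub T : rwin T \subset T.
Proof. by apply/subsetP=> x /rwinP[]. Qed.

(** A released x lies more than l to the right of some used position i, and i
    already constrains the free positions more than x does. So only the use of a
    free position releases new ones. *)
Lemma free_setU1 U x : x \in released U -> free (x |: U) = free U.
Proof.
move=> /releasedP[xU [i iU ix]]; apply/setP=> k; apply/freeP/freeP.
  case; rewrite inE negb_or => /andP[_ kU] h; split=> // j jU.
  by apply: h; rewrite inE jU orbT.
case=> kU h; have := h i iU => kil; split.
  by rewrite !inE negb_or kU andbT; apply/eqP=> ekx; move: kil ix; rewrite ekx; lia.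
move=> j /setU1P[->|]; [lia | exact: h].
Qed.

Lemma released_setU1 U x : x \in released U -> released (x |: U) = released U :\ x.
Proof.
move=> /[dup] xR /free_setU1/setP fE; apply/setP=> k.
rewrite !inE; move: (fE k); rewrite !inE negb_or.
by case: eqP => [->|_] //=; case: (k \in U) => //= ->.
Qed.

Lemma released_free U k :
  k \in free U -> {subset released U <= released (k |: U)}.
Proof.
move=> kf t /[dup] tR /releasedP[tU [i iU it]]; apply/releasedP; split.
  rewrite !inE negb_or tU andbT; apply/eqP=> etk.
  by apply: (free_released kf); rewrite -etk.
by exists i => //; rewrite inE iU orbT.
Qed.

Lemma card_setCU1 U x : x \notin U -> #|~: U| = #|~: (x |: U)|.+1.
Proof. by move=> xU; rewrite setCU setIC -setDE (cardsD1 x (~: U)) inE xU. Qed.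

Lemma completions_full win : completions win setT = 1.
Proof. by rewrite /completions setCT cards0. Qed.

Section Rec.
Variable win : {set 'I_n} -> {set 'I_n}.
Hypothesis win_sub : forall T, win T \subset T.

Lemma moves_unused U k : k \in moves win U -> k \notin U.
Proof.
rewrite inE => /orP[/freeP[]//|/(subsetP (win_sub _)) /releasedP[]//].
Qed.

Lemma completions_step U x : x \notin U ->
  completions win U = \sum_(k in moves win U) completions win (k |: U).
Proof.
move=> xU; rewrite /completions (card_setCU1 xU) /=; apply: eq_bigr => k km.
by congr count_rec; apply/eqP; rewrite -eqSS -!card_setCU1 // moves_unused.
Qed.

Lemma completions_split U x : x \notin U ->
  completions win U = \sum_(k in free U) completions win (k |: U)
                    + \sum_(k in win (released U)) completions win (k |: U).
Proof.
move=> xU; rewrite (completions_step xU) -bigU.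
  by apply: eq_bigl => k; rewrite in_setU.
rewrite disjoint_subset; apply/subsetP=> k kf; rewrite inE.
by apply/negP=> /(subsetP (win_sub _)); apply: free_released.
Qed.
End Rec.

Notation FL := (completions lwin).
Notation FR := (completions rwin).

(** * Left moves against right moves *)

Definition sumL U T := \sum_(x in lwin T) FR (x |: U).
Definition sumR U T := \sum_(x in rwin T) FR (x |: U).
(** For wide T, these are the second right moves below T, possible only because
    the first one removed the greatest element of T; they have no counterpart
    after a left move. *)
Definition excess U T :=
  \sum_(y in rwin T) \sum_(k in rwin (released U :\ y) :\: T) FR (k |: (y |: U)).

(** T is allowed to be smaller than the set of all released positions: in the
    induction a free move releases positions below T, while T is kept. *)
Definition tail U T :=
  T \subset released U /\ forall t k, t \in T -> k \notin U -> t <= k -> k \in T.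
Definition wide T := [exists x in T, [exists y in T, x + l < y]].

Lemma wideP T :
  reflect (exists x y, [/\ x \in T, y \in T & x + l < y]) (wide T).
Proof.
apply: (iffP existsP) => [[x /andP[xT /existsP[y /andP[yT xy]]]]|].
  by exists x, y.
case=> x [y [xT yT xy]]; exists x; rewrite xT; apply/existsP; exists y.
by rewrite yT.
Qed.

Lemma sumLR_narrow U T : ~~ wide T -> sumL U T = sumR U T.
Proof.
move/wideP=> nw; apply: eq_bigl => x.
by apply/lwinP/rwinP => -[xT _]; split=> // y yT; rewrite leqNgt; apply/negP=> lt;
  apply: nw; [exists x, y | exists y, x].
Qed.

Lemma tail_free U T k : tail U T -> k \in free U -> tail (k |: U) T.
Proof.
case=> TR Tup kf; split.
  by apply/subsetP=> t tT; apply: released_free => //; apply: (subsetP TR).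
by move=> t j tT; rewrite !inE negb_or => /andP[_ jU]; apply: Tup.
Qed.

Lemma tail_rem U T x : tail U T -> x \in T -> tail (x |: U) (T :\ x).
Proof.
case=> TR Tup xT; split.
  rewrite released_setU1; first exact: setSD.
  exact: (subsetP TR).
move=> t j; rewrite !inE negb_or => /andP[_ tT] /andP[jx jU] tj.
by rewrite jx (Tup t).
Qed.

Lemma tail_released U : tail U (released U).
Proof.
split=> // t k /releasedP[tU [i iU it]] kU tk; apply/releasedP; split=> //.
by exists i => //; lia.
Qed.

(** A left and a right move on a wide set commute: a left move then does not
    take the greatest element, nor a right move the least, so neither changes
    the window of the other. *)
Lemma rwin_lwinC T x k : wide T ->
  (x \in lwin T) && (k \in rwin (T :\ x)) = (k \in rwin T) && (x \in lwin (T :\ k)).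
Proof.
move=> /wideP[a [b [aT bT ab]]].
apply/andP/andP => -[].
- move=> /lwinP[xT xl] /rwinP[/setD1P[kx kT] kr].
  have xb : b != x by apply/eqP=> e; have := xl a aT; rewrite -e; lia.
  have bk : b <= k + l by apply: kr; rewrite !inE xb.
  split.
    apply/rwinP; split=> // y yT; case: (eqVneq y x) => [->|yx].
      by have := xl a aT; lia.
    by apply: kr; rewrite !inE yx.
  apply/lwinP; split; first by rewrite !inE eq_sym kx.
  by move=> y; rewrite !inE => /andP[_]; apply: xl.
move=> /rwinP[kT kr] /lwinP[/setD1P[xk xT] xl].
have ak : a != k by apply/eqP=> e; have := kr b bT; rewrite -e; lia.
have xa : x <= a + l by apply: xl; rewrite !inE ak.
split.
  apply/lwinP; split=> // y yT; case: (eqVneq y k) => [->|yk].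
    by have := kr b bT; lia.
  by apply: xl; rewrite !inE yk.
apply/rwinP; split; first by rewrite !inE eq_sym xk.
by move=> y; rewrite !inE => /andP[_]; apply: kr.
Qed.

(** After a left move the greatest element b of T is still there, and b - l is
    above the least element of T: the right window of all released positions
    stays inside T. After a right move only rwin_tail_sub holds. *)
Lemma rwin_tail U T x : tail U T -> wide T -> x \in lwin T ->
  rwin (released U :\ x) = rwin (T :\ x).
Proof.
move=> [TR Tup] /wideP[a [b [aT bT ab]]] /lwinP[xT xl].
have bx : b != x by apply/eqP=> e; have := xl a aT; rewrite -e; lia.
apply/setP=> k; apply/rwinP/rwinP => -[/setD1P[kx kR] h].
  have bk : b <= k + l by apply: h; rewrite in_setD1 bx (subsetP TR).
  case/releasedP: kR => kU _; split; first by rewrite in_setD1 kx (Tup a) //; lia.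
  by move=> y /setD1P[yx yT]; apply: h; rewrite in_setD1 yx (subsetP TR).
split; first by rewrite in_setD1 kx (subsetP TR).
move=> y /setD1P[yx /releasedP[yU _]].
case yT: (y \in T); first by apply: h; rewrite in_setD1 yx.
rewrite leqNgt; apply/negP=> ky; move/negP: yT; apply.
by apply: (Tup k) => //; lia.
Qed.

Lemma rwin_tail_sub U T y : tail U T ->
  rwin (released U :\ y) :&: T = rwin (T :\ y).
Proof.
move=> [TR Tup]; apply/setP=> k; apply/setIP/rwinP.
  case=> /rwinP[/setD1P[ky kR] h] kT; split; first by rewrite in_setD1 ky.
  by move=> z /setD1P[zy zT]; apply: h; rewrite in_setD1 zy (subsetP TR).
case=> /setD1P[ky kT] h; split=> //; apply/rwinP.
split; first by rewrite in_setD1 ky (subsetP TR).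
move=> z /setD1P[zy /releasedP[zU _]].
case zT: (z \in T); first by apply: h; rewrite in_setD1 zy.
rewrite leqNgt; apply/negP=> kz; move/negP: zT; apply.
by apply: (Tup k) => //; lia.
Qed.

Lemma wide_unused U T x : wide T -> tail U T ->
  exists y, y \notin x |: U.
Proof.
move=> /wideP[a [b [aT bT ab]]] [TR _].
case: (eqVneq a x) => [ax|ax]; [exists b|exists a];
  rewrite !inE negb_or ?ax.
  case/releasedP: (subsetP TR b bT) => -> _; rewrite andbT.
  by apply/eqP=> e; move: ab; rewrite e ax; lia.
by case/releasedP: (subsetP TR a aT).
Qed.

(** The second move is expanded and brought to the front: a free move is
    indifferent to the first move, a right move commutes with it. *)
Lemma sumL_step U T : tail U T -> wide T ->
  sumL U T = \sum_(k in free U) sumL (k |: U) T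
           + \sum_(k in rwin T) sumL (k |: U) (T :\ k).
Proof.
move=> tT wT; have [TR _] := tT.
have -> : sumL U T = \sum_(x in lwin T)
    (\sum_(k in free U) FR (k |: (x |: U))
     + \sum_(k in rwin (T :\ x)) FR (k |: (x |: U))).
  apply: eq_bigr => x xL.
  have xR : x \in released U by apply: (subsetP TR); case/lwinP: xL.
  have [y yxU] := wide_unused x wT tT.
  by rewrite (completions_split rwin_sub yxU) free_setU1 // released_setU1 //
    (rwin_tail tT).
rewrite big_split; congr (_ + _).
  rewrite exchange_big; apply: eq_bigr => k _; apply: eq_bigr => x _.
  by rewrite setUCA.
rewrite (exchange_big_dep (mem (rwin T))) /=.
  apply: eq_bigr => k kR; apply: eq_big => [x|x _]; last by rewrite setUCA.
  by rewrite rwin_lwinC // kR.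
by move=> x k xL kR; have := rwin_lwinC x k wT; rewrite xL kR => /esym/andP[].
Qed.

Lemma sumR_step U T : tail U T -> wide T ->
  sumR U T = \sum_(k in free U) sumR (k |: U) T
           + \sum_(k in rwin T) sumR (k |: U) (T :\ k) + excess U T.
Proof.
move=> tT wT; have [TR _] := tT.
have -> : sumR U T = \sum_(x in rwin T)
    (\sum_(k in free U) FR (k |: (x |: U))
     + sumR (x |: U) (T :\ x)
     + \sum_(k in rwin (released U :\ x) :\: T) FR (k |: (x |: U))).
  apply: eq_bigr => x xL.
  have xR : x \in released U by apply: (subsetP TR); case/rwinP: xL.
  have [y yxU] := wide_unused x wT tT.
  rewrite (completions_split rwin_sub yxU) free_setU1 // released_setU1 //.
  by rewrite -addnA; congr (_ + _); rewrite (big_setID T) rwin_tail_sub.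
rewrite !big_split; congr (_ + _ + _).
rewrite exchange_big; apply: eq_bigr => k _; apply: eq_bigr => x _.
by rewrite setUCA.
Qed.

Lemma card_ltC U k : k \notin U -> #|~: (k |: U)| < #|~: U|.
Proof. by move=> kU; rewrite (card_setCU1 kU). Qed.

Lemma unused_ind (P : {set 'I_n} -> Prop) :
  (forall U, (forall k, k \notin U -> P (k |: U)) -> P U) -> forall U, P U.
Proof.
move=> ih U; have [m] := ubnP #|~: U|; elim: m U => // m IHm U ltm.
by apply: ih => k kU; apply: IHm; apply: leq_trans (card_ltC kU) _.
Qed.

Lemma rwin_unused U T k : tail U T -> k \in rwin T -> k \notin U.
Proof. by case=> TR _ /rwinP[/(subsetP TR)/releasedP[]]. Qed.

Lemma free_unused U k : k \in free U -> k \notin U.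
Proof. by case/freeP. Qed.

(** sumL_step and sumR_step have matching terms at larger sets of used
    positions; the excess can only help the right side. *)
Lemma sumL_le_sumR U T : tail U T -> sumL U T <= sumR U T.
Proof.
elim/unused_ind: U T => U IH T tT.
case: (boolP (wide T)) => [wT|nw]; last by rewrite sumLR_narrow.
rewrite sumL_step // sumR_step // -[leqLHS]addn0 !leq_add //.
  by apply: leq_sum => k kf; apply: IH (free_unused kf) _ (tail_free tT kf).
apply: leq_sum => k kr; apply: IH (rwin_unused tT kr) _ _.
by apply: tail_rem => //; case/rwinP: kr.
Qed.

(** A move k counted by the excess, called d below, is released and below T, so
    d > l and d < a <= b - l - 1 for some a and b in T: then n > 2 l + 3. When
    l = 0, the only element of the right window is the greatest one of T, so a
    is still there after the first move and d >= a. *)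
Lemma excess_tight U T : (l == 0) || (n <= 2 * l + 3) ->
  tail U T -> wide T -> excess U T = 0.
Proof.
move=> tight [TR Tup] /wideP[a [b [aT bT ab]]].
apply: big1 => y yT; apply: big_pred0 => d; apply/negP=> /setDP[/rwinP[dR dl] dT].
have [dU [i iU id]] : d \notin U /\ exists2 i, i \in U & i + l < d.
  by apply/releasedP; case/setD1P: dR.
have da : d < a by rewrite ltnNge; apply: contra dT; apply: Tup.
have := ltn_ord b; case/orP: tight => [/eqP l0|]; last by lia.
have /rwinP[yT' yr] := yT.
have ay : a != y by apply/eqP=> e; have := yr b bT; rewrite -e; lia.
have : a \in released U :\ y by rewrite in_setD1 ay (subsetP TR).
by move/dl; lia.
Qed.

Lemma sumL_eq_sumR U T : (l == 0) || (n <= 2 * l + 3) ->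
  tail U T -> sumL U T = sumR U T.
Proof.
move=> tight; elim/unused_ind: U T => U IH T tT.
case: (boolP (wide T)) => [wT|nw]; last by rewrite sumLR_narrow.
rewrite sumL_step // sumR_step // excess_tight // addn0; congr (_ + _).
  by apply: eq_bigr => k kf; apply: IH (free_unused kf) _ (tail_free tT kf).
apply: eq_bigr => k kr; apply: IH (rwin_unused tT kr) _ _.
by apply: tail_rem => //; case/rwinP: kr.
Qed.

Lemma full_or_unused U : U = setT \/ exists x, x \notin U.
Proof.
case: (eqVneq U setT) => [|ne]; [by left | right].
have /set0Pn[x] : ~: U != set0 by rewrite -setCT (inj_eq (@setC_inj _)).
by rewrite inE; exists x.
Qed.

Lemma FL_le_FR U : FL U <= FR U.
Proof.
elim/unused_ind: U => U IH; have [->|[x xU]] := full_or_unused U.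
  by rewrite !completions_full.
rewrite (completions_split lwin_sub xU) (completions_split rwin_sub xU).
apply: leq_add; first by apply: leq_sum => k /free_unused/IH.
apply: leq_trans (sumL_le_sumR (tail_released U)).
by apply: leq_sum => k /lwinP[/releasedP[/IH]].
Qed.

Lemma FL_eq_FR U : (l == 0) || (n <= 2 * l + 3) -> FL U = FR U.
Proof.
move=> tight.
elim/unused_ind: U => U IH; have [->|[x xU]] := full_or_unused U.
  by rewrite !completions_full.
rewrite (completions_split lwin_sub xU) (completions_split rwin_sub xU).
congr (_ + _); first by apply: eq_bigr => k /free_unused/IH.
rewrite -[RHS](sumL_eq_sumR tight (tail_released U)).
by apply: eq_bigr => k /lwinP[/releasedP[/IH]].
Qed.

(** The greatest unused position is always a legal move. *)
Lemma FR_gt0 U : 0 < FR U.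
Proof.
elim/unused_ind: U => U IH; have [->|[x xU]] := full_or_unused U.
  by rewrite !completions_full.
rewrite (completions_step rwin_sub xU).
case: (@arg_maxnP _ x (fun k => k \notin U) (@nat_of_ord n) xU) => k kU kmax.
rewrite (bigD1 k) /=; first by rewrite addn_gt0 IH.
rewrite inE; have /orP[->//|kR] := free_or_released kU.
apply/orP; right; apply/rwinP; split=> // y /releasedP[yU _].
by have := kmax y yU; rewrite /=; lia.
Qed.

Lemma sumL_lt_sumR U T : tail U T -> wide T ->
  0 < excess U T \/ (exists2 k, k \in free U & sumL (k |: U) T < sumR (k |: U) T) ->
  sumL U T < sumR U T.
Proof.
move=> tT wT; rewrite sumL_step // sumR_step //.
have le1 k : k \in free U -> sumL (k |: U) T <= sumR (k |: U) T.
  by move=> kf; apply: sumL_le_sumR (tail_free tT kf).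
have le2 : \sum_(k in rwin T) sumL (k |: U) (T :\ k)
           <= \sum_(k in rwin T) sumR (k |: U) (T :\ k).
  apply: leq_sum => k /rwinP[kT _]; apply: sumL_le_sumR; exact: tail_rem.
have le3 : \sum_(k in free U) sumL (k |: U) T
           <= \sum_(k in free U) sumR (k |: U) T by apply: leq_sum.
case=> [e0|[k kf lt]]; first by lia.
have lt3 : \sum_(k in free U) sumL (k |: U) T
           < \sum_(k in free U) sumR (k |: U) T by exact: (ltn_sum_at kf le1 lt).
by lia.
Qed.

Lemma FL_lt_FR_of_sum U :
  sumL U (released U) < sumR U (released U) -> FL U < FR U.
Proof.
move=> lt; have [e|[x xU]] := full_or_unused U.
  suff r0 : released U = set0.
    by move: lt; rewrite sumLR_narrow ?ltnn // r0; apply/wideP=> -[? [? []]]; rewrite inE.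
  by apply/setP=> k; rewrite e !inE.
rewrite (completions_split lwin_sub xU) (completions_split rwin_sub xU).
rewrite -addnS leq_add //; first by apply: leq_sum => k _; apply: FL_le_FR.
by apply: leq_ltn_trans lt; apply: leq_sum => k _; apply: FL_le_FR.
Qed.

Lemma FL_lt_FR_move U k : k \in moves lwin U ->
  FL (k |: U) < FR (k |: U) -> FL U < FR U.
Proof.
move=> km lt; have kU := moves_unused lwin_sub km.
rewrite (completions_split rwin_sub kU).
apply: (@leq_trans (\sum_(j in free U) FR (j |: U) + sumL U (released U))); last first.
  by rewrite leq_add2l; apply: sumL_le_sumR (tail_released U).
rewrite (completions_split lwin_sub kU) /sumL.
have le (A : {set 'I_n}) : \sum_(j in A) FL (j |: U) <= \sum_(j in A) FR (j |: U).
  by apply: leq_sum => j _; apply: FL_le_FR.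
have lts (A : {set 'I_n}) :
    k \in A -> \sum_(j in A) FL (j |: U) < \sum_(j in A) FR (j |: U).
  by move=> kA; apply: (ltn_sum_at kA) => // j _; apply: FL_le_FR.
move: km; rewrite inE => /orP[] kA; first by rewrite -addSn leq_add ?lts ?le.
by rewrite -addnS leq_add ?lts ?le.
Qed.


(** * A state with a strict inequality *)

Section Witness.
Hypotheses (l_gt0 : 0 < l) (n_large : 2 * l + 4 <= n).

(* The last position n - 1 is then q + 2 l + 2. *)
Let q := n - (2 * l + 3).

Definition block (j : nat) : {set 'I_n} :=
  [set i : 'I_n | (i == q :> nat) || (q + l + 2 <= i < j)].

Lemma mem_released_block (j : nat) (i : 'I_n) : q + l + 2 <= j ->
  (i \in released (block j)) = (i == q + l + 1 :> nat) || (j <= i).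
Proof.
have qn : q < n by lia.
move=> lej; apply/releasedP/idP => [[iB [k]]|h].
  by move: iB; rewrite !inE; lia.
split; first by rewrite inE; lia.
by exists (Ordinal qn); rewrite ?inE /=; lia.
Qed.

(** Here the released positions are a = q + l + 1 and b = n - 1, more than l
    apart: a left move takes a, a right move b. If the free position p = q - 1 is
    used next, d = q + l is released. It is within l of a but not of b, hence
    available only after the right move. *)
Lemma block_last_lt : FL (block n.-1) < FR (block n.-1).
Proof.
have an : q + l + 1 < n by lia.
have bn : n.-1 < n by lia.
have dn : q + l < n by lia.
have pn : q.-1 < n by lia.
set U := block n.-1; set T := released U.
pose a := Ordinal an; pose b := Ordinal bn; pose d := Ordinal dn; pose p := Ordinal pn.
have TE i : (i \in T) = (i == q + l + 1 :> nat) || (n.-1 <= i).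
  by rewrite mem_released_block //; lia.
have wT : wide T.
  by apply/wideP; exists a, b; split; rewrite ?TE /=; lia.
have tT : tail U T by apply: tail_released.
have pf : p \in free U.
  apply/freeP; split; first by rewrite !inE /=; lia.
  by move=> i; rewrite !inE /=; lia.
apply/FL_lt_FR_of_sum/sumL_lt_sumR => //; right; exists p => //.
apply: sumL_lt_sumR => //; first exact: tail_free.
left; have bT : b \in rwin T.
  apply/rwinP; split=> [|y _]; first by rewrite TE /=; lia.
  by have := ltn_ord y; rewrite /=; lia.
rewrite /excess (bigD1 b bT) /= addn_gt0 (bigD1 d) /= ?addn_gt0 ?FR_gt0 //.
rewrite in_setD TE /=; apply/andP; split; first by lia.
apply/rwinP; split.
  rewrite in_setD1; apply/andP; split; first by apply/eqP=> /(congr1 val) /=; lia.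
  apply/releasedP; split.
    by rewrite !inE -val_eqE /=; lia.
  by exists p; rewrite ?inE ?eqxx //=; lia.
move=> z /setD1P[/eqP zb /releasedP[]]; rewrite !inE negb_or => /andP[_ zU] _ /=.
have zb' : z <> n.-1 :> nat by move=> e; apply/zb/val_inj.
have := ltn_ord z; lia.
Qed.

(** The block is filled from left to right by left moves: all its positions are
    within l of q + l + 1, the least released position. *)
Lemma block_lt (m j : nat) : j + m = n.-1 -> q + l + 2 <= j ->
  FL (block j) < FR (block j).
Proof.
elim: m j => [|m IHm] j ej lej.
  by move: ej; rewrite addn0 => ->; apply: block_last_lt.
have jn : j < n by lia.
have bE : block j.+1 = Ordinal jn |: block j.
  by apply/setP=> i; rewrite !inE -val_eqE /=; lia.
apply: (@FL_lt_FR_move _ (Ordinal jn)); last by rewrite -bE; apply: IHm; lia.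
rewrite inE; apply/orP; right; apply/lwinP; split.
  by rewrite mem_released_block //=; lia.
by move=> y; rewrite mem_released_block //=; lia.
Qed.

Lemma FL_lt_FR0 : FL set0 < FR set0.
Proof.
have qn : q < n by lia.
apply: (@FL_lt_FR_move _ (Ordinal qn)).
  by rewrite inE; apply/orP; left; apply/freeP; split=> [|i]; rewrite inE.
have -> : Ordinal qn |: set0 = block (q + l + 2).
  by apply/setP=> i; rewrite !inE -val_eqE /=; lia.
by apply: (@block_lt (n.-1 - (q + l + 2))); lia.
Qed.

End Witness.

(** * Avoiders as completions of the empty board *)

Implicit Types s g : 'S_n.
Definition below s v := [set i | s i < v].

Section Link.
Variable win : {set 'I_n} -> {set 'I_n}.
Hypothesis win_sub : forall T, win T \subset T.

(** A partial placement of the values below v is given by a full permutation g,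
    of which only the values below v matter. *)
Definition extensions g v : {set 'S_n} :=
  [set s : 'S_n | [forall i, (g i < v) ==> (s i == g i)]
     && [forall k, (v <= s k) ==> (k \in moves win (below s (s k)))]].

Lemma extensionsP g v s :
  reflect ((forall i, g i < v -> s i = g i) /\
           (forall k, v <= s k -> k \in moves win (below s (s k))))
          (s \in extensions g v).
Proof.
rewrite inE; apply: (iffP andP) => -[h1 h2]; split.
- by move=> i lt; apply/eqP; apply: (implyP (forallP h1 i)).
- by move=> k; apply/implyP/(forallP h2).
- by apply/forallP=> i; apply/implyP=> lt; apply/eqP/h1.
by apply/forallP=> k; apply/implyP/h2.
Qed.

Lemma below_eq g s v : (forall i, g i < v -> s i = g i) -> below s v = below g v.
Proof.
move=> h; apply/esym/eqP; rewrite eqEcard; apply/andP; split.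
  by apply/subsetP=> i; rewrite !inE => lt; rewrite h.
have cardB t : #|below t v| = #|[set i : 'I_n | i < v]|.
  rewrite -(card_imset _ (@perm_inj _ t)); apply: eq_card => i.
  apply/imsetP/idP => [[j + ->]|]; rewrite !inE // => iv.
  by exists (t^-1 i)%g; rewrite ?inE permKV.
by rewrite !cardB.
Qed.

(** The extensions are sorted by the position k of the value v. To fix this
    position, g is replaced by g', which exchanges the images of k and of the
    position z where g takes the value v. *)
Lemma card_extensions g v : v <= n -> #|extensions g v| = completions win (below g v).
Proof.
move Em: (n - v) => m; elim: m v Em g => [|m IHm] v Em g len.
  have ev : v = n by lia.
  have -> : below g v = setT by apply/setP=> i; rewrite !inE ev ltn_ord.
  rewrite completions_full; apply/eqP/cards1P; exists g; apply/setP=> s.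
  rewrite in_set1; apply/extensionsP/eqP => [[h _]|->].
    by apply/permP=> i; rewrite h // ev.
  by split=> // k; rewrite leqNgt ev ltn_ord.
have vn : v < n by lia.
pose V := Ordinal vn; pose z := (g^-1 V)%g.
have gz : g z = V by rewrite permKV.
have zU : z \notin below g v by rewrite inE gz /= ltnn.
rewrite (completions_step win_sub zU).
rewrite -sum1_card (partition_big (fun s => (s^-1 V)%g) (mem (moves win (below g v)))) /=.
  apply: eq_bigr => k km; have kU := moves_unused win_sub km.
  pose g' := (tperm k z * g)%g.
  have g'k : g' k = V by rewrite permM tpermL.
  have g'E i : g i < v -> g' i = g i.
    move=> lt; rewrite permM tpermD //; apply/eqP=> e.
      by move: kU; rewrite inE e lt.
    by move: lt; rewrite -e gz /= ltnn.
  have bg' : below g' v = below g v by apply: below_eq.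
  have bS s : s k = V -> below s v.+1 = k |: below s v.
    move=> sk; apply/setP=> i; rewrite !inE ltnS leq_eqVlt; congr (_ || _).
    by rewrite -(inj_eq (@perm_inj _ s)) sk.
  have <- : below g' v.+1 = k |: below g v by rewrite bS // bg'.
  rewrite -IHm //; last by lia.
  rewrite -sum1_card; apply: eq_bigl => s.
  apply/andP/extensionsP => [[/extensionsP[h1 h2] /eqP sk]|[h1 h2]].
    have {}sk : s k = V by rewrite -sk permKV.
    split=> [i|j lt]; last by apply: h2; lia.
    rewrite ltnS leq_eqVlt => /orP[/eqP e|lt].
      have -> : i = k by apply: (@perm_inj _ g'); rewrite g'k; apply: val_inj.
      by rewrite sk g'k.
    have : i \in below g' v by rewrite inE.
    by rewrite bg' inE => lt'; rewrite h1 // g'E.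
  have sk : s k = V by rewrite h1 g'k.
  have sg i : g i < v -> s i = g i.
    by move=> lt; rewrite h1 g'E //; lia.
  split; last by apply/eqP; rewrite -sk permK.
  apply/extensionsP; split=> // j; rewrite leq_eqVlt => /orP[/eqP e|]; last exact: h2.
  have ejk : j = k by apply: (@perm_inj _ s); rewrite sk; apply: val_inj.
  by rewrite -e (below_eq sg) ejk.
move=> s /extensionsP[h1 h2]; rewrite -(below_eq h1).
by have := h2 (s^-1 V)%g; rewrite permKV /=; apply.
Qed.

Lemma card_moves :
  #|[set s : 'S_n | [forall k, k \in moves win (below s (s k))]]| = completions win set0.
Proof.
have <- : below 1%g 0 = set0 by apply/setP=> i; rewrite !inE.
rewrite -card_extensions //; apply: eq_card => s; rewrite inE.
by apply/forallP/extensionsP => [h|[_ h] k]; [split | apply: h].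
Qed.

End Link.

(** The value at k, when placed, is the 2 of the occurrence. If y is the 3, then
    y is released just before this move, whatever the position of the 1. *)
Lemma Av_132_completions : Av_132 l n = FL set0.
Proof.
rewrite -(card_moves lwin_sub); apply: eq_card => s; rewrite !inE.
apply/negP/forallP => [nc k|h].
  rewrite inE; have kU : k \notin below s (s k) by rewrite inE ltnn.
  have /orP[->//|kR] := free_or_released kU.
  apply/orP; right; apply/lwinP; split=> // y /releasedP[yU [i]].
  rewrite !inE in yU *; rewrite -leqNgt in yU; move=> ik iy.
  rewrite leqNgt; apply/negP=> yk; apply: nc.
  apply/existsP; exists i; apply/existsP; exists y; apply/existsP; exists k.
  have : s k != s y :> nat by apply/eqP=> /val_inj/perm_inj e; move: yk; rewrite e; lia.
  lia.
case/existsP=> i /existsP[j /existsP[k /and4P[_ ij jk /andP[ik kj]]]].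
have iU : i \in below s (s k) by rewrite inE.
have := h k; rewrite inE => /orP[/freeP[_ /(_ i iU)]|/lwinP[_ hk]]; first by lia.
have /hk : j \in released (below s (s k)); last by lia.
by apply/releasedP; split; [rewrite inE; lia | exists i].
Qed.

(** Here too the value at k is the 2. The 3, at y, is even farther from the 1
    than k is, so y is released as soon as k is. *)
Lemma Av_123_completions : Av_123 l n = FR set0.
Proof.
rewrite -(card_moves rwin_sub); apply: eq_card => s; rewrite !inE.
apply/negP/forallP => [nc k|h].
  rewrite inE; have kU : k \notin below s (s k) by rewrite inE ltnn.
  have /orP[->//|/[dup] kR /releasedP[_ [i]]] := free_or_released kU.
  rewrite inE => ik lik; apply/orP; right; apply/rwinP; split=> // y /releasedP[yU _].
  rewrite inE -leqNgt in yU.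
  rewrite leqNgt; apply/negP=> ky; apply: nc.
  apply/existsP; exists i; apply/existsP; exists k; apply/existsP; exists y.
  have : s k != s y :> nat by apply/eqP=> /val_inj/perm_inj e; move: ky; rewrite e; lia.
  lia.
case/existsP=> i /existsP[j /existsP[k /and4P[_ ij jk /andP[sij sjk]]]].
have iU : i \in below s (s j) by rewrite inE.
have := h j; rewrite inE => /orP[/freeP[_ /(_ i iU)]|/rwinP[_ hk]]; first by lia.
have /hk : k \in released (below s (s j)); last by lia.
by apply/releasedP; split; [rewrite inE; lia | exists i => //; lia].
Qed.

End Game.

Theorem corollary6 (l n : nat) (hn : 1 <= n) :
  Av_132 l n <= Av_123 l n /\
  (Av_132 l n < Av_123 l n <-> 1 <= l /\ 2 * l + 4 <= n).
Proof.
rewrite Av_132_completions Av_123_completions.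
split; first exact: FL_le_FR.
split=> [lt|[l_gt0 n_large]]; last exact: FL_lt_FR0.
have [tight|] := boolP ((l == 0) || (n <= 2 * l + 3)); last by lia.
by move: lt; rewrite FL_eq_FR // ltnn.
Qed.
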